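(* Consider the abstract budgeted query model described in the context with the extended feedback query $\mathrm{query}_{\mathrm{ext}}$. The number of expansions made by DovIBEX using $\mathrm{query}_{\mathrm{ext}}$ (run until a terminating query is made) is at most $$2n_*\big(r_1 + r_2(1 + \lfloor \log_2 r_2\rfloor)\big),$$ where $r_1 = n_{\mathrm{exp}}(C_{\min}, C^*, \delta_{\min})$ and $r_2 = n_{\mathrm{exp}}(C_{\min}, C^*, \delta(C^* ))$.
   Context: Abstract model. Let $A$ be a nondecreasing list of real numbers, each at least $1$, possibly with repetitions (counted separately). For $C\ge 1$ let $n(C) = |\{v \in A : v \le C\}|$. Fix $C^* \in A$, $n_* = n(C^* )$, $C_{\min} = \min A$. For a budget $b$ let $C_{\mathrm{crit}}(b) = \min\{v\in A : n(v) > b\}$. Let $A_{>}(C) = \min\{v\in A: v > C\}$, $A_{\le}(C) = \max\{v \in A : v\le C\}$; for $C\in A$, $\delta(C) = A_{>}(C) - A_{\le}(C)$, and $\delta_{\min} = \min\{\delta(C): C\in A, C\le C^*\}$. Queries. A query with cost limit $C$ and budget $b$ performs at most $\min\{b,n(C)\}$ expansions; if $n_* \le n(C) \le b$ it is terminating (ends the whole interaction with an optimal solution); otherwise the extended feedback query returns $\mathrm{query}_{\mathrm{ext}}(C,b) = [A_{>}(C),\infty]$ if $C < C_{\mathrm{crit}}(b)$, and $[1,v]$ for some arbitrary $v \in [C_{\mathrm{crit}}(b), C]\cap A$ otherwise. The number of expansions of an algorithm is the sum of expansions over all its queries. Uniform Budgeted Scheduler (UBS) with a function $T:\{1,2,\ldots\}\times\{0,1,\ldots\}\to\{0,1,\ldots\}$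 and a procedure run_prog: maintain a priority queue of pairs $(k,r)$ ordered by $T(k,r)$, initially containing $(1,1)$; while nonempty, extract a pair $(k,r)$ of minimal $T$-value, call run_prog$(k, T(k,r)-T(k,r-1))$; if it does not return ''halted'', insert $(k,r+1)$; if $r = 1$, insert $(k+1,1)$. DovIBEX: UBS with $T(k,r) = r2^k$ (so each call for program $k$ has budget $2^k$) and the following run_prog$(k,b)$: retrieve program $k$'s stored interval $[C_{\mathrm{low}}, C_{\mathrm{high}}]$ (initially $[C_{\min}, \infty]$); if $C_{\mathrm{high}} = \infty$ set $C = 2C_{\mathrm{low}}$, else $C = (C_{\mathrm{low}}+C_{\mathrm{high}})/2$; replace $[C_{\mathrm{low}}, C_{\mathrm{high}}]$ by $[C_{\mathrm{low}}, C_{\mathrm{high}}]\cap \mathrm{query}_{\mathrm{ext}}(C,b)$; if $C_{\mathrm{low}} \ge C_{\mathrm{high}}$ return ''halted''; otherwise store $[C_{\mathrm{low}}, C_{\mathrm{high}}]$ as program $k$'s state. (Each call makes exactly one query; the expansions it makes are its steps.) Notation: $\lceil x\rceil_{\ge a} = \max\{a,\lceil x\rceil\}$, $\lfloor x\rfloor_{\ge a} = \max\{a, \lfloor x\rfloor\}$, $n_{\mathrm{exp}}(\varepsilon,x,\Delta) = 1 + \lceil\log_2(x/\varepsilon)\rceil_{\ge 1} + \lfloor \log_2(x/\Delta)\rfloor_{\ge 0}$. *)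

(* Defs.v *)
(* MathComp / MathComp-Analysis *)
From HB Require Import structures.
From mathcomp Require Import all_boot all_order all_algebra.
From mathcomp Require Import all_classical all_reals all_analysis.

Set Implicit Arguments.
Unset Strict Implicit.
Unset Printing Implicit Defensive.

Import Order.TTheory GRing.Theory Num.Theory.

Local Open Scope classical_set_scope.
Local Open Scope ring_scope.

(* A finite or infinite list of reals is a sequence [A : nat -> \bar R]: the
   list is made of the real entries of [A], and a finite list is continued by
   [+oo].  In all definitions below, padding entries are not elements of the
   list, and they are never counted since cost limits are real. *)

Definition cost_list (R : realType) (A : nat -> \bar R) : Prop :=
  {homo A : i j / (i <= j)%N >-> (i <= j)%E} /\ (forall i, (1 <= A i)%E).

Definition elts (R : realType) (A : nat -> \bar R) : set R :=
  [set v | exists i, A i = v%:E].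

(* Indices are counted, so repetitions count separately; the value is [+oo]
   when infinitely many entries are at most [C]. *)
Definition n_of (R : realType) (A : nat -> \bar R) (C : R) : \bar R :=
  @counting nat R [set i : nat | (A i <= C%:E)%E].

Definition Cmin (R : realType) (A : nat -> \bar R) : R := inf (elts A).

(* Minima are written as infima: a nonempty set of elements of a nondecreasing
   sequence has a least element.  The minimum of the empty set is [+oo]. *)
Definition Ccrit (R : realType) (A : nat -> \bar R) (b : nat) : \bar R :=
  ereal_inf (EFin @` [set v | elts A v /\ (b%:R%:E < n_of A v)%E]).

Definition A_gt (R : realType) (A : nat -> \bar R) (C : R) : \bar R :=
  ereal_inf (EFin @` [set v | elts A v /\ C < v]).

(* Used only for [C] in [A], where the maximum exists. *)
Definition A_le (R : realType) (A : nat -> \bar R) (C : R) : R :=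
  sup [set v | elts A v /\ v <= C].

Definition delta (R : realType) (A : nat -> \bar R) (C : R) : \bar R :=
  (A_gt A C - (A_le A C)%:E)%E.

(* Only finitely many values of [A] are at most a given element of [A], so this
   infimum is a minimum when [Cstar] is in [A]. *)
Definition delta_min (R : realType) (A : nat -> \bar R) (Cstar : R) : \bar R :=
  ereal_inf (delta A @` [set C | elts A C /\ C <= Cstar]).

Inductive response (R : realType) :=
  | Terminating
  | Feedback of (\bar R * \bar R).
Arguments Terminating {R}.

(* [query_ext A Cstar C b e q]: the query with cost limit [C] and budget [b]
   may perform [e] expansions and give the response [q].  An interval is the
   pair of its endpoints. *)
Definition query_ext (R : realType) (A : nat -> \bar R) (Cstar C : R)
    (b e : nat) (q : response R) : Prop :=
  (e%:R%:E <= Order.min b%:R%:E (n_of A C))%E /\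
  if ((n_of A Cstar <= n_of A C) && (n_of A C <= b%:R%:E))%E then q = Terminating
  else if (C%:E < Ccrit A b)%E then q = Feedback (A_gt A C, +oo%E)
  else exists v : R,
    [/\ elts A v, (Ccrit A b <= v%:E)%E, v <= C & q = Feedback (1%E, v%:E)].

Inductive outcome := Halted | Running | Solved.

(* [run_prog k b s e o s']: a call for program [k] with budget [b] and stored
   state [s] may perform [e] expansions, have outcome [o], and leave state
   [s'].  [Solved] means that a terminating query was made. *)
Definition prog_rel (S : Type) :=
  nat -> nat -> S -> nat -> outcome -> S -> Prop.

Record ubs_config (S : Type) := UbsConfig {
  queue : seq (nat * nat);
  store : nat -> S;
  expansions : nat;
  solved : bool
}.

Definition ubs_init (S : Type) (s0 : S) : ubs_config S :=
  UbsConfig [:: (1, 1)%N] (fun=> s0) 0 false.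

Definition requeue (k r : nat) (o : outcome) (q : seq (nat * nat)) :=
  (if r == 1%N then [:: (k.+1, 1%N)] else [::])
  ++ (if o is Halted then [::] else [:: (k, r.+1)])
  ++ rem (k, r) q.

(* Ties in the priority queue are broken arbitrarily. *)
Definition ubs_step (S : Type) (T : nat -> nat -> nat) (run_prog : prog_rel S)
    (c c' : ubs_config S) : Prop :=
  ~~ solved c /\
  exists k r e o s',
    [/\ (k, r) \in queue c,
        forall k' r', (k', r') \in queue c -> (T k r <= T k' r')%N,
        run_prog k (T k r - T k r.-1)%N (store c k) e o s' &
        c' = UbsConfig (requeue k r o (queue c))
                       (fun j => if j == k then s' else store c j)
                       (expansions c + e)%N
                       (if o is Solved then true else false)].

(* A run is continued by repeating its last configuration once no step is
   possible, that is, after a terminating query or if the queue is empty. *)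
Definition ubs_run (S : Type) (T : nat -> nat -> nat) (run_prog : prog_rel S)
    (s0 : S) (rho : nat -> ubs_config S) : Prop :=
  rho 0%N = ubs_init s0 /\
  forall t, ubs_step T run_prog (rho t) (rho t.+1) \/
    (forall c, ~ ubs_step T run_prog (rho t) c) /\ rho t.+1 = rho t.

(* Stored intervals have a real lower endpoint. *)
Definition dovibex_limit (R : realType) (I : \bar R * \bar R) : R :=
  if I.2 == +oo%E then 2 * fine I.1 else (fine I.1 + fine I.2) / 2.

Definition dovibex_prog (R : realType) (A : nat -> \bar R) (Cstar : R) :
    prog_rel (\bar R * \bar R) :=
  fun _ b I e o I' =>
    exists2 q, query_ext A Cstar (dovibex_limit I) b e q &
      match q with
      | Terminating => o = Solved /\ I' = I
      | Feedback J =>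
          let I1 := (Order.max I.1 J.1, Order.min I.2 J.2) in
          if (I1.2 <= I1.1)%E then o = Halted /\ I' = I
          else o = Running /\ I' = I1
      end.

Definition dovibex_run (R : realType) (A : nat -> \bar R) (Cstar : R) :
    (nat -> ubs_config (\bar R * \bar R)) -> Prop :=
  ubs_run (fun k r => r * 2 ^ k)%N (dovibex_prog A Cstar)
          ((Cmin A)%:E, +oo%E).

Definition log2 (R : realType) (x : R) : R := ln x / ln 2.

(* For [D = +oo], log2 (x / D) is -oo and the last term is 0. *)
Definition n_exp (R : realType) (eps x : R) (D : \bar R) : int :=
  1 + Order.max 1 (Num.ceil (log2 (x / eps)))
    + (if D is d%:E then Order.max 0 (Num.floor (log2 (x / d))) else 0).

(* Main.v *)
(** Since [A] is sorted, [C_crit(b)] is the entry of index [b] of [A], and a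
    query feeds back a new lower endpoint exactly when [C] is below it. Program
    [k] therefore keeps [low <= Cstar] and [low <= C_crit(2^k) <= high]. Doubling
    ends after at most [max(1, ceil(log2(Cstar/C_min)))] queries with an interval
    of length at most [Cstar], and each later query halves it. While the program
    runs the endpoints are distinct elements of [A], so the length is at least
    [delta_min], whence at most [r_1] queries; once [2^k >= n_*] it is at least
    [delta(Cstar)], the program never halts, and it solves within [r_2] queries.
    Let [k_0 >= 1] be least with [2^k_0 >= n_*], so [2^k_0 <= 2 n_*]. The
    scheduler only makes calls with [r 2^k <= r_2 2^k_0]. The programs below
    [k_0] together cost at most [r_1 2^k_0], each of the programs
    [k_0 + j] with [2^j <= r_2] costs at most [r_2 2^k_0], and no other program
    is called. *)

Require Import Defs.
From mathcomp Require Import all_boot all_order all_algebra.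
From mathcomp Require Import all_classical all_reals all_analysis.
From mathcomp Require Import finmap zify lra.

Set Implicit Arguments.
Unset Strict Implicit.
Unset Printing Implicit Defensive.

(** * Scheduling of abstract programs whose calls have budget [2 ^ k] *)

Section UniformBudget.
Variables (S : Type) (run_prog : prog_rel S) (s0 : S).
(** [Inv k n s] is meant for a state [s] of program [k] reached after [n] calls with outcome
    [Running]; bounding [n] under [Inv] bounds the number of calls. *)
Variables (k0 r1 r2 : nat) (Inv : nat -> nat -> S -> Prop).
Hypothesis k0_gt0 : 0 < k0.
Hypothesis Inv_init : forall k, Inv k 0 s0.
Hypothesis Inv_step : forall k n s e o s', Inv k n s ->
  run_prog k (2 ^ k) s e o s' ->
  e <= 2 ^ k /\
  match o with
  | Solved => True
  | Halted => k < k0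
  | Running => Inv k n.+1 s'
  end.
Hypothesis run_total : forall k s, exists e o s', run_prog k (2 ^ k) s e o s'.
Hypothesis Inv_lt_r1 : forall k n s, k < k0 -> Inv k n s -> n < r1.
Hypothesis Inv_lt_r2 : forall n s, Inv k0 n s -> n < r2.

Let T k r := r * 2 ^ k.
Let M := k0 + (trunc_log 2 r2).+1.

(* [g k] is the number of calls made to program [k] so far, and [K] is the
   latest program in the queue, not yet called. *)
Record queue_inv (c : ubs_config S) (g : nat -> nat) (K : nat) : Prop := QueueInv {
  qi_uniq : uniq (queue c);
  qi_frontier : (K, 1) \in queue c;
  qi_le : forall k r, (k, r) \in queue c -> k <= K;
  qi_count : forall k r, (k, r) \in queue c -> r = (g k).+1;
  qi_Inv : forall k r, (k, r) \in queue c -> Inv k (g k) (store c k);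
  qi_pos : forall k r, (k, r) \in queue c -> k < K -> 0 < g k;
  qi_live : forall k, k0 <= k < K -> (k, (g k).+1) \in queue c;
  qi_fresh : forall k, K < k -> g k = 0 /\ store c k = s0
}.

(* [t] counts the steps actually made, so that the bound on the calls of each
   program also forces termination. *)
Record calls_inv (t : nat) (c : ubs_config S) (g : nat -> nat) : Prop := CallsInv {
  ci_r1 : forall k, k < k0 -> g k <= r1;
  ci_r2 : forall k, g k * 2 ^ k <= r2 * 2 ^ k0;
  ci_expansions : expansions c <= \sum_(k < M) g k * 2 ^ k;
  ci_unsolved : ~~ solved c -> t = \sum_(k < M) g k /\ exists K, queue_inv c g K
}.

Lemma r2_gt0 : 0 < r2.
Proof. exact: leq_ltn_trans (Inv_lt_r2 (Inv_init k0)). Qed.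

(** A single call to a program [k >= M] has key [2 ^ k], which exceeds [r2 * 2 ^ k0] because
    [r2 < 2 ^ (trunc_log 2 r2).+1]. Hence sums over [k < M] cover all calls. *)
Lemma late_uncalled k n : n * 2 ^ k <= r2 * 2 ^ k0 -> M <= k -> n = 0.
Proof.
move=> le_n le_Mk; case: n le_n => // n le_n.
have r2_lt := trunc_log_ltn r2 (isT : 1 < 2).
suff: r2 * 2 ^ k0 < 2 ^ k by rewrite ltnNge (leq_trans _ le_n)// leq_pmull.
rewrite (leq_trans _ (leq_pexp2l _ le_Mk))// /M expnD mulnC.
by rewrite ltn_pmul2l ?expn_gt0.
Qed.

Lemma sum_incr (F : nat -> nat) g k d : k < M ->
  (forall j, j != k -> F j = g j) -> F k = g k + d ->
  \sum_(j < M) F j = \sum_(j < M) g j + d.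
Proof.
move=> ltkM Fne Fk.
rewrite (bigD1 (Ordinal ltkM)) //= [in RHS](bigD1 (Ordinal ltkM)) //= Fk addnAC.
by congr (_ + _ + _); apply: eq_bigr => j ne; apply: Fne.
Qed.

Lemma sum_calls (g : nat -> nat) : (forall k, k < k0 -> g k <= r1) ->
  (forall k, g k * 2 ^ k <= r2 * 2 ^ k0) ->
  \sum_(k < M) g k * 2 ^ k <= 2 ^ k0 * (r1 + r2 * (1 + trunc_log 2 r2)).
Proof.
move=> g1 g2.
rewrite big_split_ord /= mulnDr leq_add //.
  apply: (@leq_trans (\sum_(i < k0) r1 * 2 ^ i)).
    by apply: leq_sum => i _; rewrite leq_mul2r g1 ?orbT.
  rewrite -big_distrr /= mulnC leq_mul2r; apply/orP; right.
  have := predn_exp 2 k0; rewrite mul1n => <-; exact: leq_pred.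
apply: (@leq_trans (\sum_(i < (trunc_log 2 r2).+1) r2 * 2 ^ k0)).
  by apply: leq_sum => i _; apply: g2.
by rewrite sum_nat_const card_ord; nia.
Qed.

Lemma mem_requeue k r o q k' r' : uniq q ->
  ((k', r') \in requeue k r o q) =
    [|| (r == 1) && ((k', r') == (k.+1, 1)),
        (if o is Halted then false else (k', r') == (k, r.+1)) |
        ((k', r') != (k, r)) && ((k', r') \in q)].
Proof.
move=> uq; rewrite /requeue !mem_cat mem_rem_uniq // inE.
by case: (r == 1); case: o; rewrite ?inE ?in_nil ?orbF.
Qed.

Lemma calls_inv_step t c c' g : calls_inv t c g ->
  ubs_step T run_prog c c' -> exists g', calls_inv t.+1 c' g'.
Proof.
move=> ci [Uc [k [r [e [ o [s' [kr_q min_kr run c'E]]]]]]]; subst c'.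
have [t_eq [K qi]] := ci_unsolved ci Uc.
have def_r := qi_count qi kr_q.
have IK := qi_Inv qi kr_q.
have bud : T k r - T k r.-1 = 2 ^ k.
  by rewrite /T -mulnBl def_r /= subSnn mul1n.
rewrite bud in run.
have [le_e Io] := Inv_step IK run.
(* The extracted key is minimal, so any queued key at most [r2 * 2 ^ k0] bounds it: that of the
   frontier if [K < k0], otherwise that of [k0], which is the frontier or still live. *)
have calls_k : r * 2 ^ k <= r2 * 2 ^ k0.
  have [ltKk0|lek0K] := ltnP K k0.
    apply: leq_trans (min_kr _ _ (qi_frontier qi)) _.
    by rewrite /T leq_mul ?r2_gt0 // leq_pexp2l // ltnW.
  have [r0 k0q] : exists r0, (k0, r0) \in queue c.
    move: lek0K; rewrite leq_eqVlt => /orP[/eqP->|ltk0K].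
      by exists 1; exact: (qi_frontier qi).
    by exists (g k0).+1; apply: qi_live qi _ _; rewrite leqnn.
  apply: leq_trans (min_kr _ _ k0q) _.
  by rewrite /T leq_mul // (qi_count qi k0q) (Inv_lt_r2 (qi_Inv qi k0q)).
have ltkM : k < M.
  by rewrite ltnNge; apply/negP => /(late_uncalled calls_k); rewrite def_r.
pose g' j := if j == k then (g k).+1 else g j.
have g'ne j : j != k -> g' j = g j by rewrite /g' => /negPf->.
have g'k : g' k = (g k).+1 by rewrite /g' eqxx.
exists g'; split => /=.
- move=> j ltj; rewrite /g'; case: eqP => [jk|_]; last exact: (ci_r1 ci).
  by rewrite jk in ltj; exact: Inv_lt_r1 ltj IK.
- move=> j; rewrite /g'; case: eqP => [->|_]; last exact: (ci_r2 ci).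
  by rewrite -def_r.
- rewrite (@sum_incr (fun j => g' j * 2 ^ j) (fun j => g j * 2 ^ j) k (2 ^ k)) //.
  + by rewrite leq_add // (ci_expansions ci).
  + by move=> j /g'ne ->.
  + by rewrite g'k mulSnr.
move=> Uo.
split.
  rewrite (@sum_incr g' g k 1) //; first by rewrite addn1 -t_eq.
  by rewrite g'k addn1.
have uq := qi_uniq qi.
have memq := mem_requeue _ _ _ _ _ uq.
(* A program has at most one entry in the queue, since [g] determines the second component. *)
have other k' r' : (k', r') != (k, r) -> (k', r') \in queue c -> k' != k.
  move=> ne q'; apply: contra ne => /eqP ek; move: q'; rewrite ek => q'.
  by rewrite (qi_count qi q') -def_r.
(* Programs before the frontier have already been called, so a new program is queued exactly when
   the frontier is extracted. *)
have front : (r == 1) = (k == K).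
  apply/eqP/eqP => [r1E|kK].
    apply/eqP; rewrite eqn_leq (qi_le qi kr_q) /= leqNgt; apply/negP => ltkK.
    by have := qi_pos qi kr_q ltkK; rewrite -ltnS -def_r r1E.
  by rewrite def_r kK -(qi_count qi (qi_frontier qi)).
have lekK := qi_le qi kr_q.
have Io' : (o = Halted /\ k < k0) \/ (o = Running /\ Inv k (g k).+1 s').
  by move: Io Uo; case: (o) => //= ? _; [left|right].
exists (if r == 1 then K.+1 else K); split => /=.
- have nin r' : (k, r') \notin rem (k, r) (queue c).
    rewrite mem_rem_uniq // inE; apply/negP => /andP[ne /(other _ _ ne)].
    by rewrite eqxx.
  have nin' : k = K -> (k.+1, 1) \notin rem (k, r) (queue c).
    move=> kK; rewrite mem_rem_uniq // inE; apply/negP => /andP[_ /(qi_le qi)].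
    by rewrite kK ltnn.
  have ne1 : ((k.+1, 1) == (k, r.+1)) = false.
    by rewrite xpair_eqE (gtn_eqF (ltnSn k)).
  have Urem : uniq (rem (k, r) (queue c)) by exact: rem_uniq.
  have U2 : uniq ((if o is Halted then [::] else [:: (k, r.+1)])
      ++ rem (k, r) (queue c)).
    by case: (o); rewrite ?cat0s ?cat1s ?cons_uniq ?nin ?Urem.
  rewrite /requeue front; case: eqP => [/nin' n1|_]; last by rewrite cat0s.
  rewrite cat1s cons_uniq U2 andbT mem_cat negb_or n1 andbT.
  by case: (o); rewrite ?in_nil ?inE ?ne1.
- rewrite memq front; case: eqP => [->|nkK]; rewrite ?eqxx //=.
  have nK : (K, 1) != (k, r) by rewrite xpair_eqE eq_sym (introF eqP nkK).
  by rewrite nK (qi_frontier qi) !orbT.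
- move=> k' r'; rewrite memq => /or3P[/andP[-> /eqP[-> _]]|H|/andP[_ /(qi_le qi) H]].
  + by rewrite ltnS.
  + have -> : k' = k by move: H; case: (o) => // /eqP[].
    by case: ifP => // _; exact: leqW.
  + by case: ifP => // _; exact: leqW.
- move=> k' r'; rewrite memq => /or3P[/andP[]|H|/andP[ne q']].
  + rewrite front => /eqP kK /eqP[-> ->].
    rewrite g'ne ?(gtn_eqF (ltnSn k)) //.
    by rewrite kK; have [-> _] := qi_fresh qi (ltnSn K).
  + have [-> ->] : (k', r') = (k, r.+1) by apply/eqP; move: H; case: (o).
    by rewrite g'k def_r.
  + by rewrite g'ne ?(other _ _ ne q') //; exact: (qi_count qi q').
- move=> k' r'; rewrite memq => /or3P[/andP[]|H|/andP[ne q']].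
  + rewrite front => /eqP kK /eqP[-> _].
    have kne : k.+1 != k by rewrite (gtn_eqF (ltnSn k)).
    rewrite g'ne // (negPf kne) kK.
    by have [-> ->] := qi_fresh qi (ltnSn K).
  + have [oR -> _] : [/\ o <> Halted, k' = k & r' = r.+1].
      by move: H; case: (o) => // /eqP[-> ->].
    rewrite eqxx g'k.
    by case: Io' => [[]|[_]].
  + have ne' := other _ _ ne q'.
    by rewrite (negPf ne') g'ne //; exact: (qi_Inv qi q').
- move=> k' r'; rewrite memq => /or3P[/andP[]|H|/andP[ne q']].
  + by move=> r1E /eqP[-> _]; move: r1E; rewrite front => /eqP ->; rewrite eqxx ltnn.
  + have -> : k' = k by move: H; case: (o) => // /eqP[].
    by rewrite g'k.
  + have ne' := other _ _ ne q'.
    rewrite g'ne // => lt; apply: (qi_pos qi q').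
    move: lt; rewrite front; case: eqP => // kK; rewrite ltnS leq_eqVlt.
    by rewrite -kK (negPf ne').
(* The called program, if at least [k0], cannot have halted and so is requeued. *)
- move=> k' /andP[lek0 ltK].
  have [kk|ne] := eqVneq k' k.
    rewrite memq kk g'k def_r eqxx.
    by case: Io' => [[_]|[-> _]]; rewrite ?orbT // ltnNge -kk lek0.
  have ne2 : (k', (g k').+1) != (k, r) by rewrite xpair_eqE (negPf ne).
  have q' : (k', (g k').+1) \in queue c.
    apply: (qi_live qi); rewrite lek0 /=.
    move: ltK; rewrite front; case: eqP => // kK; rewrite ltnS leq_eqVlt.
    by rewrite -kK (negPf ne).
  by rewrite memq g'ne // ne2 q' !orbT.
- move=> k' ltk'.
  have ltK : K < k' by move: ltk'; case: ifP => // _; exact: ltnW.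
  have ne : k' != k by rewrite gtn_eqF // (leq_ltn_trans lekK).
  by rewrite g'ne // (negPf ne); exact: (qi_fresh qi ltK).
Qed.


(** The frontier keeps the queue nonempty, so an unsolved run never stalls. *)
Lemma ubs_step_total c g K : ~~ solved c -> queue_inv c g K ->
  exists c', ubs_step T run_prog c c'.
Proof.
move=> Uc qi.
have [x xq minx] : exists2 x, x \in queue c &
    forall y, y \in queue c -> T x.1 x.2 <= T y.1 y.2.
  pose P n := has (fun x => T x.1 x.2 == n) (queue c).
  have exP : exists n, P n.
    by exists (T K 1); apply/hasP; exists (K, 1) => //; exact: (qi_frontier qi).
  have [n /hasP[x xq /eqP xn] min_n] := ex_minnP exP.
  exists x => // y yq; rewrite xn; apply: min_n.
  by apply/hasP; exists y.
case: x xq minx => k r kr_q minx.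
have [e [ o [s' run]]] := run_total k (store c k).
eexists; split=> //; exists k, r, e, o, s'; split=> //.
  by move=> k' r' /minx.
by rewrite /T -mulnBl (qi_count qi kr_q) /= subSnn mul1n.
Qed.

(** Here [u] counts actual steps; it can fall behind [t] only once the run is solved and repeats
    itself. *)
Lemma calls_inv_run rho : ubs_run T run_prog s0 rho ->
  forall t, exists u g, calls_inv u (rho t) g /\ (~~ solved (rho t) -> u = t).
Proof.
move=> [rho0 rhoS]; elim=> [|t [u [g [ci IH]]]].
  exists 0, (fun=> 0); split=> //; rewrite rho0; split=> //= _.
  split; first by rewrite big1.
  exists 1; split=> //=.
  - by move=> k r; rewrite inE => /eqP[->].
  - by move=> k r; rewrite inE => /eqP[_ ->].
  - by move=> k r; rewrite inE => /eqP[-> _].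
  - by move=> k /andP[/(leq_trans k0_gt0)]; case: k.
case: (rhoS t) => [st|[stuck ->]].
  have [g' ci'] := calls_inv_step ci st.
  by exists u.+1, g'; split=> // _; rewrite IH //; case: st.
exists u, g; split=> // U.
have [_ [K qi]] := ci_unsolved ci U.
by have [c' /stuck] := ubs_step_total U qi.
Qed.

Lemma ubs_expansions rho : ubs_run T run_prog s0 rho -> forall t,
  expansions (rho t) <= 2 ^ k0 * (r1 + r2 * (1 + trunc_log 2 r2)).
Proof.
move=> run t; have [u [g [ci _]]] := calls_inv_run run t.
apply: leq_trans (ci_expansions ci) (sum_calls _ _).
  exact: (ci_r1 ci).
exact: (ci_r2 ci).
Qed.

(** Each call has weight at least 1 in the sum bounded by [B], so [B.+1] steps without a solution
    are impossible. *)
Lemma ubs_solved rho : ubs_run T run_prog s0 rho -> exists t, solved (rho t).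
Proof.
move=> run; pose B := 2 ^ k0 * (r1 + r2 * (1 + trunc_log 2 r2)).
exists B.+1; have [u [g [ci uE]]] := calls_inv_run run B.+1.
apply/negPn/negP => U; have [u_sum _] := ci_unsolved ci U.
have := sum_calls (ci_r1 ci) (ci_r2 ci).
apply/negP; rewrite -ltnNge -/B -ltnS -(uE U) u_sum ltnS.
by apply: leq_sum => k _; rewrite leq_pmulr ?expn_gt0.
Qed.

End UniformBudget.

Import Order.TTheory GRing.Theory Num.Theory.
Local Open Scope classical_set_scope.
Local Open Scope ring_scope.

(** * Counts, successors and gaps in a sorted cost list *)

Section CostList.
Variables (R : realType) (A : nat -> \bar R).
Hypothesis hA : cost_list A.

Lemma elts_fin i w : (A i <= w%:E)%E -> exists v, A i = v%:E.
Proof.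
have [_ /(_ i)] := hA; case: (A i) => [v| |] //= _ _; by exists v.
Qed.

Lemma elts_ge1 v : elts A v -> 1 <= v.
Proof. by move=> [i Ai]; have [_ /(_ i)] := hA; rewrite Ai lee_fin. Qed.

Lemma cost_le i j : (i <= j)%N -> (A i <= A j)%E.
Proof. by have [h _] := hA; exact: h. Qed.

(** By sortedness the counted indices form an initial segment; starting from 0, it contains [b]
    exactly when it has more than [b] elements. *)
Lemma lt_n_of b C : (b%:R%:E < n_of A C)%E = (A b <= C%:E)%E.
Proof.
rewrite /n_of /counting; set X := [set i | _].
apply/idP/idP => [|leC].
  apply: contraTT; rewrite -ltNge -leNgt => ltC.
  have sub : X `<=` `I_b.
    move=> i; rewrite /X /= => Ai; rewrite ltnNge; apply/negP => /cost_le lebi.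
    by have := lt_le_trans ltC (le_trans lebi Ai); rewrite ltxx.
  have finX : finite_set X by exact: sub_finite_set sub (finite_II b).
  rewrite asboolT // lee_fin ler_nat; apply: geq_card_fset_set.
  exact: subset_card_le.
case: asboolP => finX; last by rewrite ltry.
rewrite lte_fin ltr_nat; apply: leq_card_fset_set => //.
apply: subset_card_le => i /= ltib; rewrite /X /=.
by apply: le_trans leC; apply: cost_le.
Qed.

Lemma le_n_of C C' : C <= C' -> (n_of A C <= n_of A C')%E.
Proof.
move=> leCC'; rewrite /n_of /counting; set X := [set i | _]; set Y := [set i | _].
have sub : X `<=` Y by move=> i /le_trans; apply; rewrite lee_fin.
case: (asboolP (finite_set Y)) => finY; last by rewrite leey.
have finX := sub_finite_set sub finY.
by rewrite asboolT // lee_fin ler_nat fsubset_leq_card // -fset_set_sub.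
Qed.

Lemma n_of_natP C : (n_of A C < +oo)%E -> exists n, n_of A C = n%:R%:E.
Proof. by rewrite /n_of /counting; case: ifP => // _ _; eexists. Qed.

Lemma Ccrit_eq b : Ccrit A b = A b.
Proof.
have setE : [set v | elts A v /\ (b%:R%:E < n_of A v)%E] =
            [set v | elts A v /\ (A b <= v%:E)%E].
  by apply/seteqP; split=> v /= []; rewrite lt_n_of.
rewrite /Ccrit setE; apply/eqP; rewrite eq_le; apply/andP; split.
  case AbE: (A b) => [v| |]; last 1 first.
  - by have [_ /(_ b)] := hA; rewrite AbE.
  - by apply: ereal_inf_lbound; exists v => //; split; [exists b|].
  - by rewrite leey.
by apply: le_ereal_inf_tmp => _ /= [v [_ le_v] <-].
Qed.

Lemma A_gt_next C w : elts A w -> C < w -> exists v,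
  [/\ elts A v, C < v, A_gt A C = v%:E & forall u, elts A u -> C < u -> v <= u].
Proof.
move=> [i Ai] ltCw.
have exP : exists i, (C%:E < A i)%E by exists i; rewrite Ai lte_fin.
have [m ltCm min_m] := ex_minnP exP.
have [|v Am] := @elts_fin m w.
  by rewrite -Ai cost_le // min_m // Ai lte_fin.
have min_v u : elts A u -> C < u -> v <= u.
  by move=> [j Aj] ltCu; rewrite -lee_fin -Aj -Am cost_le // min_m // Aj lte_fin.
have ltCv : C < v by rewrite -lte_fin -Am.
have Av : elts A v by exists m.
exists v; split=> //.
apply/eqP; rewrite eq_le; apply/andP; split.
  by apply: ereal_inf_lbound; exists v.
by apply: le_ereal_inf_tmp => _ [u [Au ltCu] <-]; rewrite lee_fin min_v.
Qed.

Lemma Cmin_eq w : elts A w -> A 0 = (Cmin A)%:E.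
Proof.
move=> [i Ai]; have [|v A0] := @elts_fin 0%N w; first by rewrite -Ai cost_le.
rewrite A0; congr EFin; apply/eqP; rewrite eq_le.
have lbv : lbound (elts A) v.
  by move=> u [j Aj]; rewrite -lee_fin -A0 -Aj cost_le.
apply/andP; split; first by apply: lb_le_inf lbv; exists w, i.
by apply: ge_inf; [exists v|exists 0%N].
Qed.

Lemma A_le_id C : elts A C -> A_le A C = C.
Proof.
move=> AC; apply/eqP; rewrite eq_le; apply/andP; split.
  by apply: ge_sup; [exists C; split|move=> u []].
by apply: ub_le_sup; [exists C => u []|split].
Qed.

Lemma delta_le C w : elts A C -> elts A w -> C < w -> (delta A C <= (w - C)%:E)%E.
Proof.
move=> AC Aw ltCw; rewrite /delta A_le_id //.
have [v [_ _ -> min_v]] := A_gt_next Aw ltCw.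
by rewrite -EFinB lee_fin lerB // min_v.
Qed.

Lemma delta_gt0 C : elts A C -> (0 < delta A C)%E.
Proof.
move=> AC; rewrite /delta A_le_id //.
have [[w [Aw ltCw]]|no] := pselect (exists w, elts A w /\ C < w).
  have [v [_ ltCv -> _]] := A_gt_next Aw ltCw.
  by rewrite -EFinB lte_fin subr_gt0.
rewrite /A_gt (_ : [set v : R | elts A v /\ C < v] = set0) ?image_set0.
  by rewrite ereal_inf0 addye.
by apply/seteqP; split=> v //= ?; apply: no; exists v.
Qed.

Lemma delta_min_le Cstar C : elts A C -> C <= Cstar ->
  (delta_min A Cstar <= delta A C)%E.
Proof. by move=> AC leC; apply: ereal_inf_lbound; exists C. Qed.

(** Induction on an index [m] of [Cstar] gives a common positive bound for the entries up to [m];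
    any later entry that is at most [Cstar] equals it. *)
Lemma delta_min_gt0 Cstar : elts A Cstar -> (0 < delta_min A Cstar)%E.
Proof.
move=> [m Am].
have [d d0 led] : exists2 d : R, 0 < d & forall i C, (i <= m)%N -> A i = C%:E ->
    (d%:E <= delta A C)%E.
  elim: m {Am} => [|m [d d0 led]].
    case A0: (A 0%N) => [C| |]; last 2 first.
    - by exists 1 => // i C; rewrite leqn0 => /eqP->; rewrite A0.
    - by exists 1 => // i C; rewrite leqn0 => /eqP->; rewrite A0.
    have := @delta_gt0 C (ex_intro _ _ A0).
    case dE: (delta A C) => [d| |] // d0.
      exists d => // i C'; rewrite leqn0 => /eqP->.
      by rewrite A0 => -[<-]; rewrite dE.
    exists 1 => // i C'; rewrite leqn0 => /eqP->.
    by rewrite A0 => -[<-]; rewrite dE leey.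
  case Am: (A m.+1) => [C| |]; last 2 first.
  - exists d => // i C; rewrite leq_eqVlt => /orP[/eqP->|]; first by rewrite Am.
    by rewrite ltnS; exact: led.
  - exists d => // i C; rewrite leq_eqVlt => /orP[/eqP->|]; first by rewrite Am.
    by rewrite ltnS; exact: led.
  have := @delta_gt0 C (ex_intro _ _ Am).
  case dE: (delta A C) => [d'| |] // d'0.
    exists (Num.min d d'); first by rewrite lt_min d0 -lte_fin.
    move=> i C'; rewrite leq_eqVlt => /orP[/eqP->|].
      by rewrite Am => -[<-]; rewrite dE lee_fin ge_min lexx orbT.
    rewrite ltnS => le AiC; apply: le_trans (led _ _ le AiC).
    by rewrite lee_fin ge_min lexx.
  exists d => // i C'; rewrite leq_eqVlt => /orP[/eqP->|].
    by rewrite Am => -[<-]; rewrite dE leey.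
  by rewrite ltnS; exact: led.
apply: (@lt_le_trans _ _ d%:E); first by rewrite lte_fin.
apply: le_ereal_inf_tmp => _ [C [[i AiC] leC] <-].
have [leim|ltmi] := leqP i m; first exact: led leim AiC.
apply: led (leqnn m) _; rewrite Am; congr EFin; apply/eqP.
by rewrite eq_le leC -lee_fin -Am -AiC cost_le // ltnW.
Qed.

End CostList.

(** * The interval search of one program *)

Section Program.
Variables (R : realType) (A : nat -> \bar R) (Cstar : R).
Hypotheses (hA : cost_list A) (ACstar : elts A Cstar).

(* After [n] queries with budget [b]. When [high] is finite, [j.+1] queries
   were spent doubling and [i] bisecting. The strict inequality on [low] comes
   from [A_gt C > C]; it makes the doubling phase end one query earlier than the
   weak one would. *)
Definition search_inv (b n : nat) (I : \bar R * \bar R) : Prop :=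
  exists low : R,
  [/\ I.1 = low%:E, elts A low, low <= Cstar, (low%:E <= A b)%E &
      (I.2 = +oo%E /\ (n = 0%N \/ 2 ^+ n * Cmin A < low)) \/
      exists high : R, exists j i : nat,
      [/\ [/\ I.2 = high%:E, elts A high, (A b <= high%:E)%E & low < high],
          n = (j.+1 + i)%N, (j = 0%N \/ 2 ^+ j * Cmin A < Cstar) &
          high - low <= Cstar / 2 ^+ i]].

Lemma Cmin_elt : elts A (Cmin A).
Proof. by exists 0%N; rewrite (Cmin_eq hA ACstar). Qed.

Lemma Cmin_le v : elts A v -> Cmin A <= v.
Proof.
by move=> [i Ai]; rewrite -lee_fin -(Cmin_eq hA ACstar) -Ai; exact: cost_le.
Qed.

Lemma search_inv_init b : search_inv b 0 ((Cmin A)%:E, +oo%E).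
Proof.
exists (Cmin A); split=> //=; first exact: Cmin_elt.
- exact: Cmin_le.
- by rewrite -(Cmin_eq hA ACstar); exact: cost_le.
- by left; split=> //; left.
Qed.

Lemma search_inv_step b n k I e o I' : search_inv b n I ->
  dovibex_prog A Cstar k b I e o I' ->
  (e <= b)%N /\
  match o with
  | Solved => True
  | Halted => (A b <= Cstar%:E)%E
  | Running => search_inv b n.+1 I'
  end.
Proof.
case: I => I1 I2 [low [/= I1E Alow low_le low_b range]]; subst I1.
have low1 : 1 <= low by exact: elts_ge1 Alow.
have Cmin1 : 1 <= Cmin A by exact: elts_ge1 Cmin_elt.
move=> [q [le_e resp] upd]; split.
  by move: le_e; rewrite le_min lee_fin ler_nat => /andP[].
set C := dovibex_limit _ in le_e resp.
have ltC : low < C.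
  rewrite /C /dovibex_limit /=.
  by case: range => [[-> _]|[high [j [i [[-> _ _ lt] _ _ _]]]]] /=; lra.
move: resp; case: ifP => [_ qE|nterm].
  by move: upd; rewrite qE => -[-> _].
rewrite Ccrit_eq //; case: ifP => [ltCb|/negbT].
  (* Otherwise [n_of A Cstar <= n_of A C <= b], and the query would be terminating. *)
  have ltCs : C < Cstar.
    rewrite ltNge; apply/negP => /(le_n_of A) le_n; move: nterm.
    by rewrite le_n /= leNgt lt_n_of // leNgt ltCb.
  have [v [Av ltCv vE min_v]] := A_gt_next hA ACstar ltCs.
  have vb : (v%:E <= A b)%E.
    case AbE: (A b) => [u| |]; rewrite ?leey //.
      by rewrite lee_fin min_v //; [exists b|rewrite -lte_fin -AbE].
    by rewrite AbE in ltCb.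
  move=> qE; move: upd; rewrite qE /= vE.
  have -> : Order.max low%:E v%:E = v%:E.
    by rewrite max_r // lee_fin ltW // (lt_trans ltC).
  have -> : Order.min I2 +oo%E = I2 by rewrite min_l // leey.
  (* Halting means [high <= v], whence [A b <= high <= v <= Cstar]. *)
  case: ifP => [le2 [-> _]|/negbT].
    case: range => [[I2E _]|[high [j [i [[I2E _ bh _] _ _ _]]]]].
      by move: le2; rewrite I2E.
    apply: le_trans bh _; rewrite -I2E (le_trans le2) // lee_fin.
    exact: min_v.
  rewrite -ltNge => lt2 [-> ->]; exists v; split=> //=; first exact: min_v.
  case: range => [[I2E g]|[high [j [i [[I2E Ah bh lt] nE g len]]]]].
    left; split=> //; right.
    apply: le_lt_trans _ ltCv; rewrite /C /dovibex_limit I2E /= exprS -mulrA.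
    rewrite ler_pM2l //; case: g => [->|/ltW//].
    by rewrite expr0 mul1r; exact: Cmin_le.
  right; exists high, j, i.+1; split=> //; last 2 first.
  - by rewrite nE addnS.
  - move: ltCv; rewrite /C /dovibex_limit I2E /= exprS => ltCv.
    rewrite invfM mulrCA mulrC; lra.
  by split=> //; rewrite -lte_fin -I2E.
rewrite -leNgt => bC [v [Av bv vC qE]].
move: upd; rewrite qE.
have -> /= : Order.max low%:E 1%E = low%:E by rewrite max_l // lee_fin.
have -> : Order.min I2 v%:E = v%:E.
  rewrite min_r //; case: range => [[-> _]|[high [j [i [[I2E _ _ lt] _ _ _]]]]].
    by rewrite leey.
  rewrite I2E lee_fin (le_trans vC) // /C /dovibex_limit I2E /=; lra.
(* Here halting means [v <= low], whence [A b <= v <= low <= Cstar]. *)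
case: ifP => [le2 [-> _]|/negbT].
  by apply: le_trans bv (le_trans le2 _); rewrite lee_fin.
rewrite -ltNge lte_fin => ltlv [-> ->]; exists low; split=> //=; right.
case: range => [[I2E g]|[high [j [i [[I2E Ah bh lt] nE g len]]]]].
  (* The query that makes [high] finite is the extra one in [j.+1], with [j = n]; the length is at
     most [2 * low - low <= Cstar]. *)
  exists v, n, 0%N; split=> //; first by rewrite addn0.
    by case: g => [->|g]; [left|right; exact: lt_le_trans low_le].
  move: vC; rewrite /C /dovibex_limit I2E /= expr0 divr1; lra.
exists v, j, i.+1; split=> //; first by rewrite nE addnS.
move: vC; rewrite /C /dovibex_limit I2E /= exprS => vC.
rewrite invfM mulrCA mulrC; lra.
Qed.

(** A query may always make 0 expansions, and the entry [A b] is an admissible upper feedback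
    whenever it is at most [C]. *)
Lemma search_total k b I : exists e o I', dovibex_prog A Cstar k b I e o I'.
Proof.
set C := dovibex_limit I.
have [q hq] : exists q, query_ext A Cstar C b 0 q.
  have ge0 : (0%:R%:E <= Order.min b%:R%:E (n_of A C))%E.
    rewrite le_min lee_fin ler_nat /= /n_of /counting.
    by case: ifP => _; rewrite ?leey // lee_fin.
  rewrite /query_ext (Ccrit_eq hA).
  case: ((n_of A Cstar <= n_of A C) && (n_of A C <= b%:R%:E))%E.
    by exists Terminating.
  have [_|leC] := ltP C%:E (A b); first by eexists; split; [|reflexivity].
  have [v Abv] := elts_fin hA leC.
  exists (Feedback (1%E, v%:E)); split=> //; exists v; split=> //.
  - by exists b.
  - by rewrite Abv.
  - by rewrite -lee_fin -Abv.
case: q hq => [|J] hq; first by exists 0%N, Solved, I, Terminating.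
case h: (Order.min I.2 J.2 <= Order.max I.1 J.1)%E.
  by exists 0%N, Halted, I, (Feedback J); rewrite //= h.
exists 0%N, Running, (Order.max I.1 J.1, Order.min I.2 J.2), (Feedback J) => //=.
by rewrite h.
Qed.

End Program.

(** * Logarithmic bounds on the number of queries *)

Lemma log2_exp (R : realType) (n : nat) : log2 (2 ^+ n : R) = n%:R.
Proof.
rewrite /log2 lnXn ?ltr0n // -[_ *+ n]mulr_natl mulfK //.
by rewrite gt_eqF // ln_gt0 ?ltr1n. Qed.

Lemma le_log2 (R : realType) (x y : R) : 0 < x -> x <= y -> log2 x <= log2 y.
Proof.
move=> x0 lexy; rewrite ler_pM2r ?invr_gt0 ?ln_gt0 ?ltr1n //.
by rewrite ler_ln ?posrE // (lt_le_trans x0).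
Qed.

Lemma lt_log2 (R : realType) (x y : R) : 0 < x -> x < y -> log2 x < log2 y.
Proof.
move=> x0 ltxy; rewrite ltr_pM2r ?invr_gt0 ?ln_gt0 ?ltr1n //.
by rewrite ltr_ln ?posrE // (lt_trans x0).
Qed.

Lemma trunc_log_le_floor (R : realType) n : (0 < n)%N ->
  (trunc_log 2 n)%:Z <= Num.floor (log2 (n%:R : R)).
Proof.
move=> n0; rewrite floor_ge_int -pmulrn -(log2_exp _ (trunc_log 2 n)).
by apply: le_log2; rewrite ?exprn_gt0 // -natrX ler_nat trunc_logP.
Qed.

Lemma n_exp_ge2 (R : realType) (eps x : R) D : 2 <= n_exp eps x D.
Proof.
rewrite /n_exp; set c := Order.max 1 _; set f := (if D is d%:E then _ else 0).
have c1 : 1 <= c by rewrite le_max lexx.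
have f0 : 0 <= f by rewrite /f; case: (D) => // d; rewrite le_max lexx.
by clearbody c f; lia.
Qed.

(** Serves both call bounds, with [D] the minimal gap or the gap at [Cstar]. Writing [n = j.+1 + i],
    the doubling count satisfies [j < c] and the bisection count [i <= f]. *)
Lemma search_inv_lt_n_exp (R : realType) (A : nat -> \bar R) Cstar b n I D :
  cost_list A -> elts A Cstar -> search_inv A Cstar b n I -> (0 < D)%E ->
  (forall low high, elts A low -> elts A high -> low < high -> low <= Cstar ->
     (A b <= high%:E)%E -> (D <= (high - low)%:E)%E) ->
  n%:Z < n_exp (Cmin A) Cstar D.
Proof.
move=> hA AC [low [_ Alow low_le low_b range]] D0 gap; rewrite /n_exp.
set c := Order.max 1 _; set f := (if D is d%:E then _ else 0).
have Cmin0 : 0 < Cmin A.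
  by apply: lt_le_trans (elts_ge1 hA (Cmin_elt hA AC)).
(* The strict [2 ^+ j * Cmin A < Cstar] puts [j] below the ceiling; the floor value 1 of the maximum
   covers [j = 0]. *)
have c_lt j : j = 0%N \/ 2 ^+ j * Cmin A < Cstar -> j%:Z < c.
  rewrite lt_max; case=> [->//|lt]; apply/orP; right.
  rewrite ceil_gt_int -pmulrn -(log2_exp _ j).
  apply: lt_log2; first by rewrite exprn_gt0.
  by rewrite ltr_pdivlMr.
have f0 : 0 <= f by rewrite /f; case: (D) => // d; rewrite le_max lexx.
case: range => [[_ g]|[high [j [i [[_ Ah bh lt] -> jc len]]]]].
  have : n%:Z < c.
    by apply: c_lt; case: g => [|g]; [left|right; exact: lt_le_trans low_le].
  by clearbody c f; lia.
have leD := gap _ _ Alow Ah lt low_le bh.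
(* From [d <= high - low <= Cstar / 2 ^+ i] follows [2 ^+ i <= Cstar / d]; an infinite [D] cannot
   lie below a real length. *)
have le_f : i%:Z <= f.
  rewrite /f; move: D0 leD; case: (D) => // d; rewrite lte_fin lee_fin => d0 led.
  rewrite le_max floor_ge_int -pmulrn -(log2_exp _ i); apply/orP; right.
  apply: le_log2; first by rewrite exprn_gt0.
  rewrite ler_pdivlMr // mulrC -ler_pdivlMr ?exprn_gt0 //.
  exact: le_trans led len.
by have := c_lt _ jc; clearbody c f; lia.
Qed.

(** [0 < k] is required because the scheduler starts at program 1; when this forces [k = 1], the
    bound is [2 <= 2 * N]. Otherwise minimality gives [2 ^ k.-1 <= N]. *)
Lemma pow2_scale N : (0 < N)%N ->
  exists k, [/\ (0 < k)%N, (N <= 2 ^ k)%N & (2 ^ k <= 2 * N)%N].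
Proof.
move=> N0.
have exP : exists k, (0 < k)%N && (N <= 2 ^ k)%N.
  by exists N; rewrite N0 ltnW // ltn_expl.
have [k /andP[k0 leN] min_k] := ex_minnP exP.
exists k; split=> //; case: k k0 leN min_k => // -[|k] _ _ min_k; first by lia.
rewrite expnS leq_mul2l /= leqNgt.
by apply/negP => /ltnW /(min_k k.+1); rewrite ltnn.
Qed.

Theorem theorem4 (R : realType) (A : nat -> \bar R) (Cstar : R)
    (hA : cost_list A) (hCstar : elts A Cstar)
    (rho : nat -> ubs_config (\bar R * \bar R))
    (hrho : dovibex_run A Cstar rho) :
  let r1 : int := n_exp (Cmin A) Cstar (delta_min A Cstar) in
  let r2 : int := n_exp (Cmin A) Cstar (delta A Cstar) in
  (forall t : nat,
     ((expansions (rho t))%:R%:E <=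
        2%:E * n_of A Cstar *
        (r1 + r2 * (1 + Num.floor (log2 (r2%:~R : R))))%:~R%:E)%E) /\
  ((n_of A Cstar < +oo)%E -> exists t : nat, solved (rho t)).
Proof.
move=> r1 r2.
have [m1 r1E] : exists m, r1 = m%:Z.
  exists `|r1|%N; rewrite gez0_abs //; exact: le_trans (n_exp_ge2 _ _ _).
have [m2 r2E] : exists m, r2 = m%:Z.
  exists `|r2|%N; rewrite gez0_abs //; exact: le_trans (n_exp_ge2 _ _ _).
have r1_ge2 : 2 <= r1 by exact: n_exp_ge2.
have r2_ge2 : 2 <= r2 by exact: n_exp_ge2.
rewrite r1E r2E in r1_ge2 r2_ge2 *.
have m2_gt0 : (0 < m2)%N by lia.
have le_log := trunc_log_le_floor R m2_gt0.
have n_gt0 : (0%:R%:E < n_of A Cstar)%E.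
  by rewrite lt_n_of // (Cmin_eq hA hCstar) lee_fin (Cmin_le hA hCstar).
have [n_fin|] := ltP (n_of A Cstar) +oo%E; last first.
  (* With infinite [n_of A Cstar] the bound is [+oo], its other factors being positive. *)
  rewrite leye_eq => /eqP nE; rewrite nE; split=> [t|//].
  rewrite gt0_muley ?lte_fin // gt0_mulye ?leey // lte_fin ltr0z.
  set L := Num.floor _; have : 0 <= L by apply: le_trans le_log.
  by move: m2_gt0 r1_ge2; clear; nia.
have [N nE] := n_of_natP n_fin.
have N_gt0 : (0 < N)%N by move: n_gt0; rewrite nE lte_fin ltr_nat.
have [k0 [k0_gt0 leN le2N]] := pow2_scale N_gt0.
pose Inv k := search_inv A Cstar (2 ^ k)%N.
have Inv_init k : Inv k 0%N ((Cmin A)%:E, +oo%E) by exact: search_inv_init.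
have Inv_step k n s e o s' : Inv k n s ->
    dovibex_prog A Cstar k (2 ^ k)%N s e o s' ->
    (e <= 2 ^ k)%N /\
    match o with
    | Solved => True
    | Halted => (k < k0)%N
    | Running => Inv k n.+1 s'
    end.
  move=> I run; have [le_e Io] := search_inv_step hA hCstar I run.
  split=> //; case: (o) Io => //.
  rewrite -lt_n_of // nE lte_fin ltr_nat => lt; rewrite ltnNge; apply/negP => le.
  have := leq_trans leN (leq_pexp2l (isT : (0 < 2)%N) le).
  by rewrite leqNgt lt.
have Inv_lt1 k n s : (k < k0)%N -> Inv k n s -> (n < m1)%N.
  move=> _ I; rewrite -ltz_nat -r1E.
  apply: search_inv_lt_n_exp I _ _ => //; first exact: delta_min_gt0.
  move=> low high Al Ah lt le _.
  exact: le_trans (delta_min_le Al le) (delta_le hA Al Ah lt).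
have Inv_lt2 n s : Inv k0 n s -> (n < m2)%N.
  move=> I; rewrite -ltz_nat -r2E.
  apply: search_inv_lt_n_exp I _ _ => //; first exact: delta_gt0.
  move=> low high Al Ah _ le bh.
  (* Since [N <= 2 ^ k0], the entry of index [2 ^ k0] exceeds [Cstar], so the interval spans the
     whole gap above [Cstar]. *)
  have ltC : Cstar < high.
    rewrite -lte_fin; apply: lt_le_trans bh.
    by rewrite ltNge -lt_n_of // nE lte_fin ltr_nat -leqNgt.
  by apply: le_trans (delta_le hA hCstar Ah ltC) _; rewrite lee_fin lerB.
have total k s := search_total Cstar hA k (2 ^ k)%N s.
split=> [t|_]; last first.
  exact: (ubs_solved k0_gt0 Inv_init Inv_step total Inv_lt1 Inv_lt2 hrho).
have le_exp := ubs_expansions k0_gt0 Inv_init Inv_step total Inv_lt1 Inv_lt2 hrho t.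
rewrite nE -!EFinM lee_fin -natrM.
apply: (@le_trans _ _ ((2 * N * (m1 + m2 * (1 + trunc_log 2 m2)))%N%:R)).
  by rewrite ler_nat (leq_trans le_exp) // leq_mul2r le2N orbT.
rewrite natrM ler_pM2l ?ltr0n ?muln_gt0 ?N_gt0 // -[leLHS]/(_%:Z%:~R) ler_int.
by rewrite PoszD lerD2l PoszM ler_pM2l // PoszD lerD2l.
Qed.
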